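(* Let $X\subset\mathbb P^r$, $r\ge 3$, be a closed projective scheme whose defining ideal $I_X$ has a graded minimal free resolution of the form $$0 \to R \xrightarrow{\rho=(\tau,0)} R^3\oplus R^{n-3}\xrightarrow{\varphi=\alpha\kappa\oplus\delta}R^n\xrightarrow{\gamma}R$$ (shifts omitted), where $\tau(1)=(h_1,h_2,h_3)$ with $h_1,h_2,h_3$ a regular sequence, $\kappa:R^3\to R^3$ is the central map of the Koszul complex on $h_1,h_2,h_3$, $\alpha:R^3\to R^n$ and $\delta:R^{n-3}\to R^n$ are maps, and $\gamma$ is given by the row $(B_1,\ldots,B_n)$, with $B_i$ equal to $(-1)^i$ times the minor obtained by removing the $i$-th row of the $(n+1)\times n$ matrix $B$ whose first $n$ rows are the matrix of $\alpha\oplus\delta:R^3\oplus R^{n-3}\to R^n$ and whose last row is $(h_1,h_2,h_3,0,\ldots,0)$. Let $Z$ be the complete intersection scheme defined by the ideal $I(\tau)=(h_1,h_2,h_3)$, let $S=V(\det(\alpha\oplus\delta))$, and let $Y$ be the scheme defined by the ideal of maximal minors of $B$. If $\operatorname{codim}(S\cap Z)=4$, then $X=Y\cup Z$.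
   Context: $k$ is a field, $R$ is the homogeneous coordinate ring (a standard graded polynomial ring over $k$) of $\mathbb P^r$, and $n\ge 3$; all maps and matrices are homogeneous. For maps $\sigma:F\to G$ and $\delta:F'\to G$, $\sigma\oplus\delta:F\oplus F'\to G$ denotes $(u,v)\mapsto\sigma(u)+\delta(v)$. The Koszul map $\kappa$ has matrix $\begin{pmatrix}0 & h_3 & -h_2\\ -h_3 &0 & h_1\\ h_2 & -h_1 & 0\end{pmatrix}$. The codimension of $S\cap Z$ is the height of the ideal $(\det(\alpha\oplus\delta),h_1,h_2,h_3)$. The union of two closed subschemes is the scheme defined by the intersection of their ideals. *)

(* Defs.v *)
From HB Require Import structures.
From mathcomp Require Import all_boot all_order all_algebra.
From mathcomp Require Import mpoly.

Set Implicit Arguments.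
Unset Strict Implicit.
Unset Printing Implicit Defensive.

Import GRing.Theory.
Local Open Scope ring_scope.

(* The ideals of ssralg / ring_quotient are boolean predicates; the ideals
   below are Prop-valued, so that no decidability is assumed of them. *)

Section Ideals.
Variable A : comNzRingType.
Implicit Types (I J P : A -> Prop) (s : seq A).

Definition is_ideal I :=
  [/\ I 0, forall f g, I f -> I g -> I (f + g) & forall f g, I g -> I (f * g)].

Definition sub_ideal I J := forall f, I f -> J f.

Definition eq_ideal I J := forall f, I f <-> J f.

Definition cap_ideal I J : A -> Prop := fun f => I f /\ J f.

Definition gen_ideal s : A -> Prop :=
  fun f => exists c : 'I_(size s) -> A, f = \sum_(i < size s) c i * s`_i.

Definition is_prime P :=
  [/\ is_ideal P, ~ P 1 & forall f g, P (f * g) -> P f \/ P g].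

(* [C 0 < C 1 < ... < C l] is a strict chain of primes ending at P *)
Definition prime_chain P (l : nat) (C : nat -> A -> Prop) :=
  [/\ forall i, (i <= l)%N -> is_prime (C i),
      forall i, (i < l)%N -> sub_ideal (C i) (C i.+1) /\
                             ~ sub_ideal (C i.+1) (C i)
    & eq_ideal (C l) P].

Definition prime_height_ge P (l : nat) := exists C, prime_chain P l C.

(* The height of an ideal is the least height of a prime containing it; the
   unit ideal has no (finite) height. *)
Definition has_height I (l : nat) :=
  (forall P, is_prime P -> sub_ideal I P -> prime_height_ge P l) /\
  (exists P, [/\ is_prime P, sub_ideal I P & ~ prime_height_ge P l.+1]).

Definition regular_sequence s :=
  (forall i, (i < size s)%N ->
     forall f, gen_ideal (take i s) (f * s`_i) -> gen_ideal (take i s) f) /\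
  ~ gen_ideal s 1.

End Ideals.

Section Subschemes.
Variables (k : fieldType) (r : nat).
Local Notation R := {mpoly k[r.+1]}.

Definition homogeneous_ideal (I : R -> Prop) :=
  forall (d : nat) f, I f -> I (pihomog mdeg d f).

Definition saturation (I : R -> Prop) : R -> Prop :=
  fun f => forall i : 'I_r.+1, exists N : nat, I ('X_i ^+ N * f).

(* Closed subschemes of P^r correspond bijectively to saturated homogeneous
   ideals of R. *)
Record subscheme := Subscheme {
  defining_ideal :> R -> Prop;
  subscheme_ideal : is_ideal defining_ideal;
  subscheme_homog : homogeneous_ideal defining_ideal;
  subscheme_sat : sub_ideal (saturation defining_ideal) defining_ideal }.

Definition eq_subscheme (X Y : subscheme) := eq_ideal X Y.

(* X = V(J): an arbitrary homogeneous ideal determines a subscheme only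
   through its saturation. *)
Definition defined_by (X : subscheme) (J : R -> Prop) :=
  eq_ideal X (saturation J).

Lemma pihomogM_homog (d e : nat) (f g : R) : g \is e.-homog ->
  pihomog mdeg (d + e) (f * g) = pihomog mdeg d f * g.
Proof.
move=> hg; pose K := maxn (mmeasure mdeg f) d.+1.
rewrite {1}(@pihomog_partitionE _ _ mdeg K f) ?leq_maxl // mulr_suml linear_sum /=.
have dK : (d < K)%N by rewrite leq_maxr.
rewrite (bigD1 (Ordinal dK)) //= big1 ?addr0 => [|i /eqP ne].
  by rewrite pihomog_dE // dhomogM // pihomogP.
rewrite (@pihomog_ne0 _ _ mdeg (i + e)%N) ?dhomogM ?pihomogP //.
by rewrite eqn_add2r; apply/eqP => h; apply: ne; apply: val_inj.
Qed.

Lemma saturation_ideal I : is_ideal I -> is_ideal (saturation I).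
Proof.
move=> [I0 ID IM]; split=> [i|f g If Ig i|f g Ig i].
- by exists 0%N; rewrite mulr0.
- have [[N HN] [M HM]] := (If i, Ig i); exists (N + M)%N.
  rewrite mulrDr; apply: ID; last by rewrite exprD -mulrA; apply: IM.
  by rewrite addnC exprD -mulrA; apply: IM.
- by have [N HN] := Ig i; exists N; rewrite mulrCA; apply: IM.
Qed.

Lemma saturation_homog I : homogeneous_ideal I -> homogeneous_ideal (saturation I).
Proof.
move=> hI d f sf i; have [N HN] := sf i; exists N.
have hX : ('X_i ^+ N : R) \is N.-homog.
  by rewrite -[N in N.-homog]mul1n; apply: dhomogMn; rewrite dhomogX; apply/eqP; exact: mdeg1.
by rewrite mulrC -(pihomogM_homog _ _ hX) mulrC; apply: hI.
Qed.

Lemma saturation_sat I : sub_ideal (saturation (saturation I)) (saturation I).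
Proof.
move=> f sf i; have [N /(_ i) [M H]] := sf i.
by exists (M + N)%N; rewrite exprD -mulrA.
Qed.

Lemma subscheme_exists J : is_ideal J -> homogeneous_ideal J ->
  exists X : subscheme, defined_by X J.
Proof.
move=> iJ hJ.
by exists (Subscheme (saturation_ideal iJ) (saturation_homog hJ)
             (@saturation_sat J)).
Qed.

Section Union.
Variables X Y : subscheme.

Lemma cap_is_ideal : is_ideal (cap_ideal X Y).
Proof.
have [X0 XD XM] := subscheme_ideal X; have [Y0 YD YM] := subscheme_ideal Y.
by split=> // [f g [Xf Yf] [Xg Yg]|f g [Xg Yg]]; split;
  by [apply: XD|apply: YD|apply: XM|apply: YM].
Qed.

Lemma cap_homog : homogeneous_ideal (cap_ideal X Y).
Proof. by move=> d f [Xf Yf]; split; apply: subscheme_homog. Qed.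

Lemma cap_sat : sub_ideal (saturation (cap_ideal X Y)) (cap_ideal X Y).
Proof.
by move=> f sf; split; apply: subscheme_sat => i;
  have [N [HX HY]] := sf i; exists N.
Qed.

Definition union_subscheme := Subscheme cap_is_ideal cap_homog cap_sat.

End Union.
End Subschemes.

Section GradedResolutions.
Variables (k : fieldType) (r : nat).
Local Notation R := {mpoly k[r.+1]}.

Definition homog_of_degree (d : int) (f : R) : Prop :=
  match d return Prop with Posz d' => f \is d'.-homog | Negz _ => f = 0 end.

(* A p x q matrix is the map R^q -> R^p, v |-> M *m v, on column vectors. It
   is homogeneous (of degree 0) from \oplus_j R(- src j) to
   \oplus_i R(- tgt i) when its (i, j) entry has degree src j - tgt i. *)
Definition homog_mx p q (src : 'I_q -> int) (tgt : 'I_p -> int)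
    (M : 'M[R]_(p, q)) :=
  forall i j, homog_of_degree (src j - tgt i) (M i j).

(* all entries lie in the irrelevant ideal *)
Definition minimal_mx p q (M : 'M[R]_(p, q)) := forall i j, (M i j)@_0%MM = 0.

Definition exact_at p q s (M : 'M[R]_(p, q)) (N : 'M[R]_(s, p)) :=
  forall v : 'cV[R]_p, N *m v = 0 <-> exists u : 'cV[R]_q, v = M *m u.

(* 0 -> \oplus R(- e _) -> \oplus R(- c _) -> \oplus R(- b _) -> R
   with maps rho, phi, gamma is a graded minimal free resolution of R / I *)
Definition minimal_graded_resolution p q s (I : R -> Prop)
    (e : 'I_s -> int) (c : 'I_q -> int) (b : 'I_p -> int)
    (rho : 'M[R]_(q, s)) (phi : 'M[R]_(p, q)) (gamma : 'M[R]_(1, p)) :=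
  [/\ [/\ homog_mx e c rho, homog_mx c b phi & homog_mx b (fun=> 0) gamma],
      [/\ minimal_mx rho, minimal_mx phi & minimal_mx gamma]
    & [/\ forall u : 'cV[R]_s, rho *m u = 0 -> u = 0,
          exact_at rho phi,
          exact_at phi gamma
        & forall f, I f <-> exists u : 'cV[R]_p, f = (gamma *m u) 0 0]].

End GradedResolutions.

Section Construction.
Variable A : comNzRingType.

Definition tau_mx (h1 h2 h3 : A) : 'cV[A]_3 := \col_i [:: h1; h2; h3]`_i.

Definition kappa_mx (h1 h2 h3 : A) : 'M[A]_3 :=
  \matrix_(i, j) (nth [::] [:: [::    0;   h3; - h2];
                               [:: - h3;    0;   h1];
                               [::   h2; - h1;    0]] i)`_j.

(* the (n+1) x n matrix with the row w appended below M *)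
Definition add_last_row n (M : 'M[A]_n) (w : 'rV[A]_n) : 'M[A]_(n.+1, n) :=
  \matrix_(i, j) if unlift ord_max i is Some i' then M i' j else w 0 j.

Definition maximal_minor n (B : 'M[A]_(n.+1, n)) (i : 'I_n.+1) : A :=
  \det (row' i B : 'M_n).

Definition maximal_minors_ideal n (B : 'M[A]_(n.+1, n)) : A -> Prop :=
  gen_ideal [seq maximal_minor B i | i <- enum 'I_n.+1].

(* Rows are numbered from 0 here, hence the exponent i.+1. *)
Definition signed_minors_row n (B : 'M[A]_(n.+1, n)) : 'rV[A]_n :=
  \row_(i < n) ((-1) ^+ i.+1 * maximal_minor B (lift ord_max i)).

(* alpha : R^3 -> R^n and delta : R^(n-3) -> R^n, with n = 3 + m; row_mx is
   the operation (+) on maps with a common target. *)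
Definition B_mx m (h1 h2 h3 : A) (alpha : 'M[A]_(3 + m, 3))
    (delta : 'M[A]_(3 + m, m)) : 'M[A]_((3 + m).+1, 3 + m) :=
  add_last_row (row_mx alpha delta) (row_mx (tau_mx h1 h2 h3)^T 0).

End Construction.

(* Main.v *)
From HB Require Import structures.
Require Import Defs.
From mathcomp Require Import all_boot all_order all_algebra.
From mathcomp Require Import mpoly ring.
From mathcomp Require boolp classical_sets.

(** The scheme X is cut out by the maximal minors of B that involve the last row
    (h1, h2, h3, 0, ..., 0), and Y by these together with the one remaining
    minor D, the determinant of (alpha, delta). Expansion along the last row puts
    the minors defining X in I(Z) = (h1, h2, h3), so X contains Y and Z.
    Conversely let f vanish on Y and Z. Up to a power of each variable,
    f = g + u D with g in I_X, so u D lies in I(Z). If D is a nonzero divisor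
    modulo I(Z), then u lies in I(Z), and u D lies in I_X because Cramer's rule
    ([det_mul_last_row]) gives h_j D in I_X. Since I_X is saturated, f is in I_X.

    That D is a nonzero divisor modulo I(Z) is where the codimension hypothesis
    enters, through Macaulay's theorem that an ideal generated by a regular
    sequence has no embedded primes ([unmixedness]). It is proved by comparing
    two regular sequences. A proper ideal K over which all primes have height greater
    than c contains, after inverting the nonzero polynomials in a suitable set S
    of variables, a regular sequence of more than c polynomials, each of them in
    a single variable outside S ([separated_regular]). That there are enough
    variables outside S is a dimension count, in which a chain of primes is
    turned into independent elements of the polynomial ring and monomials are
    counted ([height_add_independent]). On the other hand, the vanishing of
    Koszul cohomology shows that an ideal which kills a nonzero element modulo a
    regular sequence of length c contains no regular sequence longer than c
    ([regular_exchange]). *)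

Set Implicit Arguments.
Unset Strict Implicit.
Unset Printing Implicit Defensive.

Import GRing.Theory.
Local Open Scope ring_scope.

(** * Ideals and regular sequences *)

Section Adjoin.
Variable A : comNzRingType.
Implicit Types (J T : A -> Prop) (fs hs : seq A) (f h t u : A).

Lemma idealB J f g : is_ideal J -> J f -> J g -> J (f - g).
Proof. by case=> _ JD JM Jf Jg; apply: JD => //; rewrite -mulN1r; apply: JM. Qed.

Lemma idealMr J f g : is_ideal J -> J f -> J (f * g).
Proof. by case=> _ _ JM Jf; rewrite mulrC; apply: JM. Qed.

Lemma ideal_sum J (I : finType) (F : I -> A) : is_ideal J ->
  (forall i, J (F i)) -> J (\sum_i F i).
Proof. by case=> J0 JD _ JF; apply: (big_ind J). Qed.

Definition adjoin J f : A -> Prop := fun a => exists c, J (a - c * f).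

Lemma adjoin_ideal J f : is_ideal J -> is_ideal (adjoin J f).
Proof.
move=> iJ; have [J0 JD JM] := iJ; split=> [|a b [c Hc] [d Hd]|a b [c Hc]].
- by exists 0; rewrite mul0r subr0.
- by exists (c + d); rewrite mulrDl opprD addrACA; apply: JD.
- by exists (a * c); rewrite -mulrA -mulrBr; apply: JM.
Qed.

Lemma adjoin_sub J f : sub_ideal J (adjoin J f).
Proof. by move=> a Ja; exists 0; rewrite mul0r subr0. Qed.

Lemma adjoin_gen J f c : is_ideal J -> adjoin J f (c * f).
Proof. by case=> J0 _ _; exists c; rewrite subrr. Qed.

Lemma foldl_adjoin_ideal J hs : is_ideal J -> is_ideal (foldl adjoin J hs).
Proof. by elim: hs J => [//|h hs IH] J iJ; apply: IH; apply: adjoin_ideal. Qed.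

Definition mult_closed T := T 1 /\ forall s t, T s -> T t -> T (s * t).

(** Regularity after inverting T, phrased in the original ring: each entry is
    cancelled modulo J and the entries before it at the cost of a factor in T.
    For the polynomials of k[S] this replaces the passage to the ring of
    polynomials over the field k(S). *)
Fixpoint regular_upto T J fs : Prop :=
  if fs is f :: fs' then
    (forall a, J (f * a) -> exists2 t, T t & J (t * a))
      /\ regular_upto T (adjoin J f) fs'
  else True.

End Adjoin.

Section GeneratedIdeals.
Variable A : comNzRingType.
Implicit Types (s : seq A) (J T : A -> Prop).

Definition zero_ideal : A -> Prop := fun f => f = 0.

Lemma zero_ideal_is_ideal : is_ideal zero_ideal.
Proof. by split=> // [f g -> ->|f g ->]; rewrite /zero_ideal ?addr0 ?mulr0. Qed.

Lemma colon_ideal J u : is_ideal J -> is_ideal (fun f => J (f * u)).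
Proof.
move=> [J0 JD JM]; split=> [|f g Jf Jg|f g Jg]; first by rewrite mul0r.
  by rewrite mulrDl; apply: JD.
by rewrite -mulrA; apply: JM.
Qed.

Lemma gen_ideal_min s J : is_ideal J -> (forall x, x \in s -> J x) ->
  sub_ideal (gen_ideal s) J.
Proof.
move=> iJ sJ f [c ->]; apply: ideal_sum => // i; case: iJ => _ _; apply.
by apply: sJ; apply: mem_nth.
Qed.

Lemma gen_ideal_mem s x : x \in s -> gen_ideal s x.
Proof.
move=> xs; have lt : (index x s < size s)%N by rewrite index_mem.
exists (fun i => (i == Ordinal lt)%:R); rewrite (bigD1 (Ordinal lt)) //= eqxx mul1r.
by rewrite nth_index // big1 ?addr0 // => i /negPf ->; rewrite mul0r.
Qed.

Lemma gen_ideal_is_ideal s : is_ideal (gen_ideal s).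
Proof.
split.
- by exists (fun=> 0); rewrite big1 // => i _; rewrite mul0r.
- move=> f g [c ->] [d ->]; exists (fun i => c i + d i).
  by rewrite -big_split; apply: eq_bigr => i _; rewrite mulrDl.
- move=> f g [c ->]; exists (fun i => f * c i).
  by rewrite mulr_sumr; apply: eq_bigr => i _; rewrite mulrA.
Qed.

(** Generators can thus be added one at a time, the form in which the inductions
    on regular sequences below proceed. *)
Lemma foldl_adjoin_gen s :
  eq_ideal (foldl (@adjoin A) zero_ideal s) (gen_ideal s).
Proof.
have iG := gen_ideal_is_ideal s; move=> f; split.
  suff main hs : {subset hs <= s} -> forall J, sub_ideal J (gen_ideal s) ->
      sub_ideal (foldl (@adjoin A) J hs) (gen_ideal s).
    by apply: main => // g ->; case: iG.
  elim: hs => [//|h hs IH] sub J sJ; apply: IH => [x xs|g [c Jc]].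
    by apply: sub; rewrite inE xs orbT.
  rewrite -(subrK (c * h) g); have [_ GD GM] := iG.
  apply: GD; first exact: sJ.
  by apply: GM; apply: gen_ideal_mem; apply: sub; rewrite mem_head.
apply: gen_ideal_min; first exact: foldl_adjoin_ideal zero_ideal_is_ideal.
elim: s (zero_ideal) zero_ideal_is_ideal {iG} => [//|h s IH] J iJ x /=.
rewrite inE => /orP [/eqP ->|xs]; last by apply: IH => //; apply: adjoin_ideal.
have : adjoin J h h by rewrite -[X in adjoin J h X]mul1r; apply: adjoin_gen.
elim: (s) (adjoin J h) => [//|g s' IHs] J' J'h /=; apply: IHs.
exact: adjoin_sub.
Qed.

Lemma regular_sequence_upto T s : mult_closed T ->
  regular_sequence s -> regular_upto T zero_ideal s.
Proof.
move=> [T1 _] [reg _].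
have: s = [::] ++ s by []; rewrite -[zero_ideal]/(foldl (@adjoin A) zero_ideal [::]).
move: {2 3}s [::]; elim=> [//|h post IH] pre Es; split.
  move=> a /foldl_adjoin_gen Ja; exists 1; rewrite ?mul1r //.
  apply/foldl_adjoin_gen; have := reg (size pre) _ a.
  rewrite Es take_size_cat // nth_cat ltnn subnn /= size_cat /= addnS ltnS leq_addr.
  by move=> /(_ isT); apply; rewrite mulrC.
by rewrite -foldl_rcons; apply: IH; rewrite cat_rcons.
Qed.

End GeneratedIdeals.

(** * Koszul cohomology and the exchange of regular sequences *)

Section Koszul.
Variable A : comNzRingType.
Implicit Types (J T : A -> Prop) (fs hs : seq A) (f h t u : A).

(** The Koszul cochain complex is built as an iterated mapping cone: a cochain on
    f :: fs is a pair of cochains on fs, and the differential of the cone of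
    multiplication by f brings in the only sign that is needed. *)
Fixpoint koszul fs : lmodType A :=
  if fs is _ :: fs' then (koszul fs' * koszul fs')%type : lmodType A else A^o.

Fixpoint kdiff fs : koszul fs -> koszul fs :=
  match fs with
  | [::] => fun=> 0
  | f :: fs' => fun x => (kdiff x.1, f *: x.1 - kdiff x.2)
  end.

(** Cohomological degrees are shifted by one, so that scalars have degree 1 and
    degree 0 contains only the zero cochain. Scalars are then compared with
    boundaries of the zero cochain, and the lowest degree requires no separate
    clause in [acyclic_below]. *)
Fixpoint kdeg fs (i : nat) : koszul fs -> Prop :=
  match fs with
  | [::] => fun x => i = 1%N \/ x = 0
  | f :: fs' => fun x => kdeg i x.1 /\ kdeg i.-1 x.2
  end.

Fixpoint kin J fs : koszul fs -> Prop :=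
  match fs with
  | [::] => fun x => J x
  | f :: fs' => fun x => kin J x.1 /\ kin J x.2
  end.

Lemma kdiffD fs (x y : koszul fs) : kdiff (x + y) = kdiff x + kdiff y.
Proof.
elim: fs x y => [|f fs IH] /= x y; first by rewrite addr0.
by rewrite !IH; congr pair; rewrite /= scalerDr opprD addrACA.
Qed.

Lemma kdiffZ fs a (x : koszul fs) : kdiff (a *: x) = a *: kdiff x.
Proof.
elim: fs x => [|f fs IH] /= x; first by rewrite scaler0.
by rewrite !IH; congr pair; rewrite /= scalerBr !scalerA mulrC.
Qed.

Lemma kdiff0 fs : kdiff (0 : koszul fs) = 0.
Proof. by have := kdiffZ 0 (0 : koszul fs); rewrite !scale0r. Qed.

Lemma kdiffB fs (x y : koszul fs) : kdiff (x - y) = kdiff x - kdiff y.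
Proof. by rewrite -scaleN1r kdiffD kdiffZ scaleN1r. Qed.

Lemma kdiff_kdiff fs (x : koszul fs) : kdiff (kdiff x) = 0.
Proof.
elim: fs x => [//|f fs IH] /= x.
by congr pair; rewrite /= ?kdiffB ?kdiffZ ?IH ?subr0 ?subrr.
Qed.

Lemma kdeg0 fs (x : koszul fs) : kdeg 0 x -> x = 0.
Proof.
by elim: fs x => [|f fs IH] /= x; [case|case: x => ? ? [/IH/= -> /IH/= ->]].
Qed.

Lemma kdeg_0 fs i : kdeg i (0 : koszul fs).
Proof. by elim: fs i => [|f fs IH] /= i; [right|split; apply: IH]. Qed.

Lemma kdegD fs i (x y : koszul fs) : kdeg i x -> kdeg i y -> kdeg i (x + y).
Proof.
elim: fs i x y => [|f fs IH] /= i x y.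
  by case=> [->|->]; [left|case=> [->|->]; [left|right; rewrite addr0]].
by move=> [? ?] [? ?]; split; apply: IH.
Qed.

Lemma kdegZ fs i a (x : koszul fs) : kdeg i x -> kdeg i (a *: x).
Proof.
elim: fs i x => [|f fs IH] /= i x; last by case=> ? ?; split; apply: IH.
by case=> ->; [left|right; rewrite scaler0].
Qed.

Lemma kdegB fs i (x y : koszul fs) : kdeg i x -> kdeg i y -> kdeg i (x - y).
Proof. by move=> Hx Hy; rewrite -scaleN1r; apply: kdegD => //; apply: kdegZ. Qed.

Lemma kdeg_kdiff fs i (x : koszul fs) : kdeg i x -> kdeg i.+1 (kdiff x).
Proof.
elim: fs i x => [|f fs IH] /= i x; first by right.
move=> [Hx Hy]; split; first exact: IH.
case: i Hx Hy => [|i] Hx Hy; last by apply: kdegB; [apply: kdegZ|apply: IH].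
by rewrite (kdeg0 Hx) (kdeg0 Hy) scaler0 kdiff0 subrr; apply: kdeg_0.
Qed.

Lemma kin_sub J J' fs (x : koszul fs) : sub_ideal J J' -> kin J x -> kin J' x.
Proof.
move=> sJ; elim: fs x => [|f fs IH] /= x; first exact: sJ.
by case=> ? ?; split; apply: IH.
Qed.

Section Membership.
Variable J : A -> Prop.
Hypothesis iJ : is_ideal J.

Lemma kin0 fs : kin J (0 : koszul fs).
Proof. by elim: fs => [|f fs IH] /=; [case: iJ|]. Qed.

Lemma kinD fs (x y : koszul fs) : kin J x -> kin J y -> kin J (x + y).
Proof.
elim: fs x y => [|f fs IH] /= x y; first by case: iJ => _ JD _; apply: JD.
by move=> [? ?] [? ?]; split; apply: IH.
Qed.

Lemma kinZ fs a (x : koszul fs) : kin J x -> kin J (a *: x).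
Proof.
elim: fs x => [|f fs IH] /= x; first by case: iJ => _ _; apply.
by case=> ? ?; split; apply: IH.
Qed.

Lemma kinB fs (x y : koszul fs) : kin J x -> kin J y -> kin J (x - y).
Proof. by move=> Hx Hy; rewrite -scaleN1r; apply: kinD => //; apply: kinZ. Qed.

Lemma kin_kdiff fs (x : koszul fs) : kin J x -> kin J (kdiff x).
Proof.
elim: fs x => [|f fs IH] /= x; first by move=> _; apply: (kin0 [::]).
by case=> Hx Hy; split; [apply: IH|apply: kinB; [apply: kinZ|apply: IH]].
Qed.

Lemma kin_scale_adjoin f fs (x : koszul fs) : kin (adjoin J f) (f *: x).
Proof.
elim: fs x => [|g fs IH] /= x; last by split; apply: IH.
by rewrite /GRing.scale /= mulrC; apply: adjoin_gen.
Qed.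

Lemma kin_adjoin h fs i (x : koszul fs) : kdeg i x -> kin (adjoin J h) x ->
  exists2 y, kdeg i y & kin J (x - h *: y).
Proof.
elim: fs i x => [|f fs IH] /= i x.
  case=> [-> [c Jc]|-> _]; first by exists c; [left|rewrite mulrC in Jc].
  by exists 0; [right|rewrite scaler0 subrr; apply: (kin0 [::])].
move=> [dx dy] [/(IH _ _ dx) [v dv Jv] /(IH _ _ dy) [w dw Jw]].
by exists (v, w).
Qed.

Lemma kin_cancel T h fs (x : koszul fs) : mult_closed T ->
  (forall a, J (h * a) -> exists2 t, T t & J (t * a)) ->
  kin J (h *: x) -> exists2 t, T t & kin J (t *: x).
Proof.
move=> [_ TM] Hh; elim: fs x => [|f fs IH] /= x; first exact: Hh.
move=> [/IH [s Ts Js] /IH [t Tt Jt]]; exists (s * t); first exact: TM.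
by split; [rewrite mulrC|]; rewrite -scalerA; apply: kinZ.
Qed.

End Membership.

(** Vanishing of the Koszul cohomology of fs on the quotient by J, after
    inverting T, in the n lowest degrees. Cochains of the quotient are
    represented by cochains of the ring whose components matter up to J. *)
Definition acyclic_below T J fs (n : nat) : Prop :=
  forall i (x : koszul fs), (i < n)%N -> kdeg i.+1 x -> kin J (kdiff x) ->
  exists t y, [/\ T t, kdeg i y & kin J (t *: x - kdiff y)].

Variable T : A -> Prop.
Hypothesis mT : mult_closed T.

(** Induction on fs with J growing: for (x1, x2) closed modulo J, the equation
    f x1 = d x2 shows that x2 is closed modulo J and f, hence t x2 = d w + f v
    modulo J. Then f (t x1 - d v) vanishes modulo J, and cancelling f exhibits
    (x1, x2) as the boundary of (v, - w), up to T. *)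
Lemma regular_acyclic J fs : is_ideal J -> regular_upto T J fs ->
  acyclic_below T J fs (size fs).
Proof.
have [T1 TM] := mT.
elim: fs J => [|f fs IH] //= J iJ [Hf Hfs] i [x1 x2] /= ltin [dx1 dx2] [J1 J2].
have [t [v [w [Tt dv dw Hvw]]]] : exists t v w,
  [/\ T t, kdeg i v, kdeg i.-1 w & kin J (t *: x2 - kdiff w - f *: v)].
  case: i ltin dx1 dx2 => [|i] ltin dx1 dx2.
    exists 1, 0, 0; split=> //; try exact: kdeg_0.
    by rewrite (kdeg0 dx2) !scaler0 kdiff0 !subrr; apply: kin0.
  have /(IH _ (adjoin_ideal f iJ) Hfs i x2 ltin dx2) [t [w [Tt dw]]] :
      kin (adjoin J f) (kdiff x2).
    rewrite -[kdiff x2](subKr (f *: x1)); apply: (kinB (adjoin_ideal f iJ)).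
      exact: kin_scale_adjoin.
    exact: kin_sub (@adjoin_sub _ J f) J2.
  have dz : kdeg i.+1 (t *: x2 - kdiff w).
    by apply: kdegB; [apply: kdegZ|apply: kdeg_kdiff].
  by move=> /(kin_adjoin iJ dz) [v dv Jv]; exists t, v, w.
have : kin J (f *: (t *: x1 - kdiff v)).
  have /= := kinD iJ (kinZ iJ t J2) (kin_kdiff iJ Hvw).
  rewrite !kdiffB kdiff_kdiff subr0 !kdiffZ !scalerBr addrA addrNK.
  by rewrite !scalerA [t * f]mulrC.
move=> /(kin_cancel iJ mT Hf) [s Ts Hs].
exists (s * t), (s *: v, - (s *: w)); split; first exact: TM.
  split=> /=; first exact: kdegZ.
  by rewrite -sub0r; apply: kdegB; [apply: kdeg_0|apply: kdegZ].
split=> /=; first by rewrite kdiffZ -scalerA -scalerBr.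
have := kinZ iJ s Hvw.
rewrite -[- (s *: w)]scaleNr kdiffZ scaleNr opprK [f *: (_ *: _)]scalerA.
by rewrite [f * s]mulrC !scalerBr !scalerA opprD addrA addrAC.
Qed.

(** In the long exact sequence of multiplication by h, each cohomology group of
    the quotient by h lies between groups of two consecutive degrees, so one
    degree of vanishing is lost. Explicitly, if d x = h y modulo J then h d y = 0,
    so y is a boundary d z, and x - h z is closed modulo J. *)
Lemma acyclic_adjoin J h fs n : is_ideal J -> acyclic_below T J fs n.+1 ->
  (forall a, J (h * a) -> exists2 t, T t & J (t * a)) ->
  acyclic_below T (adjoin J h) fs n.
Proof.
have [_ TM] := mT; move=> iJ Hac Hh i x ltin dx Jx.
have [y dy Hy] := kin_adjoin iJ (kdeg_kdiff dx) Jx.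
have : kin J (h *: kdiff y).
  rewrite -[h *: _]opprK -scaleN1r; apply: (kinZ iJ).
  have := kin_kdiff iJ Hy.
  by rewrite kdiffB kdiff_kdiff sub0r kdiffZ.
move=> /(kin_cancel iJ mT Hh) [t Tt]; rewrite -kdiffZ.
have ltin1 : (i.+1 < n.+1)%N by [].
move=> /(Hac i.+1 (t *: y) ltin1 (kdegZ t dy)) [s [z [Ts dz Hz]]].
have dw : kdeg i.+1 ((s * t) *: x - h *: z) by apply: kdegB; apply: kdegZ.
have Jw : kin J (kdiff ((s * t) *: x - h *: z)).
  rewrite kdiffB !kdiffZ.
  have := kinD iJ (kinZ iJ (s * t) Hy) (kinZ iJ h Hz).
  by rewrite !scalerBr !scalerA [h * _]mulrC addrA subrK.
have ltin' : (i < n.+1)%N by apply: ltnW.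
have [r [w [Tr dw' Hw]]] := Hac i _ ltin' dw Jw.
exists (r * (s * t)), w; split=> //; first by apply: (TM) => //; apply: TM.
have := kinD (adjoin_ideal h iJ) (kin_sub (@adjoin_sub _ J h) Hw)
  (kinZ (adjoin_ideal h iJ) r (kin_scale_adjoin iJ h z)).
by rewrite scalerBr !scalerA addrAC subrK.
Qed.

Fixpoint kunit fs (u : A) : koszul fs :=
  if fs is f :: fs' then (kunit fs' u, 0) else u.

Lemma kdeg_kunit fs u : kdeg 1 (kunit fs u).
Proof. by elim: fs => [|f fs IH] /=; [left|split=> //; apply: kdeg_0]. Qed.

Lemma kin_kunit J fs u : is_ideal J -> kin J (kunit fs u) <-> J u.
Proof.
move=> iJ; elim: fs => [//|f fs IH] /=; rewrite IH.
by split=> [[]|Ju] //; split=> //; apply: kin0.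
Qed.

Lemma kunitZ fs a u : a *: kunit fs u = kunit fs (a * u).
Proof. by elim: fs => [//|f fs IH] /=; rewrite -IH; congr pair; rewrite /= scaler0. Qed.

Lemma kin_kdiff_kunit J fs u : is_ideal J ->
  (forall f, f \in fs -> J (f * u)) -> kin J (kdiff (kunit fs u)).
Proof.
move=> iJ; elim: fs => [|f fs IH] H /=; first by case: iJ.
split; first by apply: IH => g gfs; apply: H; rewrite inE gfs orbT.
rewrite kdiff0 subr0 kunitZ; apply/kin_kunit => //.
by apply: H; rewrite mem_head.
Qed.

(** Each entry of hs costs one degree of vanishing, so the Koszul cohomology of
    the longer sequence fs modulo hs still vanishes in the lowest degree, where a
    scalar u killed by every entry of fs is a cocycle. This is the fact behind the equal length of all maximal
    regular sequences of an ideal. *)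
Theorem regular_exchange J fs hs u : is_ideal J ->
  regular_upto T J fs -> regular_upto T J hs -> (size hs < size fs)%N ->
  (forall f, f \in fs -> foldl (@adjoin A) J hs (f * u)) ->
  exists2 t, T t & foldl (@adjoin A) J hs (t * u).
Proof.
move=> iJ rfs rhs ltsz Hu; have := foldl_adjoin_ideal hs iJ.
have : acyclic_below T (foldl (@adjoin A) J hs) fs (size fs - size hs).
  have := regular_acyclic iJ rfs; move: (size fs) ltsz => n.
  elim: hs J iJ {rfs} rhs n {Hu} => [|h hs IH] J iJ /= rhs n ltn Hac.
    by rewrite subn0.
  case: n ltn Hac => // n ltn Hac; rewrite subSS; apply: IH => //.
  - exact: adjoin_ideal.
  - by case: rhs.
  by apply: acyclic_adjoin => //; case: rhs.
set I := foldl _ _ _ in Hu * => Hac iI.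
have lt0 : (0 < size fs - size hs)%N by rewrite subn_gt0.
have [t [y [Tt /kdeg0 ->]]] :=
  Hac 0%N _ lt0 (kdeg_kunit fs u) (kin_kdiff_kunit iI Hu).
rewrite kdiff0 subr0 kunitZ => /(kin_kunit _ _ iI).
by exists t.
Qed.

End Koszul.

(** * Primes avoiding a multiplicative set *)

Lemma prime_avoiding (A : comNzRingType) (K T : A -> Prop) :
  is_ideal K -> mult_closed T -> (forall t, T t -> ~ K t) ->
  exists P, [/\ is_prime P, sub_ideal K P & forall t, T t -> ~ P t].
Proof.
move=> iK [T1 TM] dK.
pose good (I : A -> Prop) :=
  [/\ is_ideal I, sub_ideal K I & forall t, T t -> ~ I t].
have good_max_prime P : good P ->
    (forall I, good I -> sub_ideal P I -> sub_ideal I P) -> is_prime P.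
  move=> [iP KP dP] maxP; split=> // [|f g Pfg]; first exact: dP.
  (* By maximality, P and a generate an ideal that meets T. *)
  have meetT a : ~ P a -> exists t c, T t /\ P (t - c * a).
    move=> nPa; apply: boolp.contrapT => nT; apply: nPa.
    apply: (maxP (adjoin P a)); last first.
    - by exists 1; rewrite mul1r subrr; case: iP.
    - exact: adjoin_sub.
    split; first exact: adjoin_ideal.
      by move=> b Kb; apply: adjoin_sub; apply: KP.
    by move=> t Tt [c Pc]; apply: nT; exists t, c.
  have [Pf|nPf] := boolp.EM (P f); first by left.
  right; apply: boolp.contrapT => nPg.
  have [s [c [Ts Ps]]] := meetT _ nPf; have [t [e [Tt Pt]]] := meetT _ nPg.
  apply: (dP (s * t)); first exact: TM.
  have [P0 PD PM] := iP.
  have -> : s * t = t * (s - c * f) + (c * f) * (t - e * g) + (c * e) * (f * g).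
    by ring.
  by apply: (PD); [apply: (PD)|]; apply: PM.
(* The empty set is let through, as the union of the empty chain. *)
have [F chainF|P [goodP maxP]] :=
  @classical_sets.Zorn_bigcup A (fun I => (exists x, I x) -> good I).
  move=> totF [x [X0 FX0 X0x]].
  have goodF X x' : F X -> X x' -> good X.
    by move=> FX Xx; apply: chainF => //; exists x'.
  have [iX KX _] := goodF _ _ FX0 X0x.
  split; [split|..].
  - by exists X0 => //; case: iX.
  - move=> f g [X FX Xf] [Y FY Yg].
    have [XY|YX] := totF _ _ FX FY.
      exists Y => //; have [[_ YD _] _ _] := goodF _ _ FY Yg.
      by apply: YD => //; apply: XY.
    exists X => //; have [[_ XD _] _ _] := goodF _ _ FX Xf.
    by apply: XD => //; apply: YX.
  - move=> f g [X FX Xg]; exists X => //.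
    by case: (goodF _ _ FX Xg) => [[_ _ XM] _ _]; apply: XM.
  - by move=> f Kf; exists X0 => //; apply: KX.
  - by move=> t Tt [X FX Xt]; case: (goodF _ _ FX Xt) => _ _ /(_ t Tt).
have goodK : good K by split.
have [[x Px]|P0] := boolp.EM (exists x, P x); last first.
  case: (maxP K) => //; split; first by move=> x Px; case: P0; exists x.
  by move=> /(_ 0) KP; case: P0; exists 0; apply: KP; case: iK.
have gP : good P by apply: goodP; exists x.
exists P; case: (gP) => iP KP dP; split=> //.
apply: good_max_prime => // I gI sPI; apply: boolp.contrapT => nIP.
by apply: (maxP I) => [|_]; first by split.
Qed.

(** * Polynomials in some of the variables *)

(** Modulo J, the leading coefficient of g kills the top coefficient of a; after
    multiplication by it that coefficient can be discarded, and the degree of a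
    drops. *)
Lemma ideal_lead_coef (A : idomainType) (J : A -> Prop) (g a : {poly A}) :
  is_ideal J -> (forall j, J (g * a)`_j) ->
  exists N, forall j, J (lead_coef g ^+ N * a`_j).
Proof.
move=> iJ; have [J0 JD JM] := iJ; have [n] := ubnP (size a).
elim: n a => // n IH a ltan Hga; set c := lead_coef g in IH *.
have [->|nz_a] := eqVneq a 0; first by exists 0%N => j; rewrite coef0 mulr0.
have Jc : J (c * lead_coef a) by rewrite -lead_coefM lead_coefE.
set d := (size a).-1; set b := c *: (a - lead_coef a *: 'X^d).
have lta : (size (a - lead_coef a *: 'X^d)%R < size a)%N.
  rewrite -(prednK (_ : 0 < size a)%N) ?size_poly_gt0 // ltnS.
  apply/leq_sizeP => j; rewrite coefB coefZ coefXn leq_eqVlt => /orP [/eqP<-|ltj].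
    by rewrite eqxx mulr1 -lead_coefE subrr.
  rewrite gtn_eqF // mulr0 subr0; apply: nth_default.
  by rewrite -[size a]prednK // size_poly_gt0.
have [||N HN] := IH b.
- exact: leq_ltn_trans (size_scale_leq _ _) (leq_trans lta _).
- move=> j; rewrite /b -scalerAr coefZ mulrBr coefB mulrBr; apply: idealB => //.
    exact: JM.
  rewrite -scalerAr coefZ mulrA; apply: idealMr => //.
exists N.+1 => j; have := HN j; rewrite /b coefZ coefB coefZ coefXn mulrBr mulrBr.
move=> HJ; rewrite exprSr -mulrA.
suff : J (c ^+ N * (c * (lead_coef a * (j == d)%:R))).
  by move=> /(JD _ _ HJ); rewrite subrK.
by apply: JM; rewrite mulrA; apply: idealMr.
Qed.

Section Variables.
Variables (k : fieldType) (n : nat).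
Local Notation R := {mpoly k[n]}.
Implicit Types (S : {set 'I_n}) (z i : 'I_n) (p q : R).

Definition in_vars S p :=
  forall m, m \in msupp p -> forall i, i \notin S -> m i = 0%N.

Lemma in_varsD S p q : in_vars S p -> in_vars S q -> in_vars S (p + q).
Proof.
move=> Hp Hq m /msuppD_le; rewrite mem_cat => /orP []; [exact: Hp|exact: Hq].
Qed.

Lemma in_varsC S (c : k) : in_vars S c%:MP.
Proof.
move=> m; rewrite msuppC; case: eqP => // _; rewrite inE => /eqP -> i _.
by rewrite mnm0E.
Qed.

Lemma in_varsM S p q : in_vars S p -> in_vars S q -> in_vars S (p * q).
Proof.
move=> Hp Hq m /msuppM_le /allpairsP [[m1 m2] /= [/Hp H1 /Hq H2 ->]] i iS.
by rewrite mnmDE H1 // H2.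
Qed.

Lemma in_varsX S i : i \in S -> in_vars S 'X_i.
Proof.
move=> iS m; rewrite msuppX inE => /eqP -> j; rewrite mnm1E.
by case: eqP => // <-; rewrite iS.
Qed.

Lemma in_vars0 S : in_vars S 0. Proof. by rewrite -mpolyC0; apply: in_varsC. Qed.
Lemma in_vars1 S : in_vars S 1. Proof. by rewrite -mpolyC1; apply: in_varsC. Qed.

Lemma in_varsXn S i e : i \in S -> in_vars S ('X_i ^+ e).
Proof.
move=> iS; elim: e => [|e IH]; first by rewrite expr0; apply: in_vars1.
by rewrite exprS; apply: in_varsM => //; apply: in_varsX.
Qed.

Lemma in_vars_sum S (I : Type) (r : seq I) (P : pred I) (F : I -> R) :
  (forall x, P x -> in_vars S (F x)) -> in_vars S (\sum_(x <- r | P x) F x).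
Proof.
by move=> H; apply: (big_ind (in_vars S)) => //; [apply: in_vars0|apply: in_varsD].
Qed.

Lemma in_vars_prod S (I : Type) (r : seq I) (P : pred I) (F : I -> R) :
  (forall x, P x -> in_vars S (F x)) -> in_vars S (\prod_(x <- r | P x) F x).
Proof.
by move=> H; apply: (big_ind (in_vars S)) => //; [apply: in_vars1|apply: in_varsM].
Qed.

Lemma in_vars_set0 p : in_vars set0 p -> exists c, p = c%:MP.
Proof.
move=> Hp; exists p@_0%MM; apply/mpolyP => m; rewrite mcoeffC.
have [->|m0] := eqVneq m 0%MM; first by rewrite mulr1.
rewrite mulr0; apply: memN_msupp_eq0; apply: contra m0 => mp; apply/eqP/mnmP => i.
by rewrite mnm0E; apply: Hp => //; rewrite inE.
Qed.

(** A polynomial regarded as a univariate polynomial in the variable z. The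
    coefficients stay in the same ring, which avoids renumbering variables. *)
Definition isolate z : R -> {poly R} :=
  mmap (polyC \o @mpolyC n k) (fun i => if i == z then 'X else ('X_i)%:P).

HB.instance Definition _ z := GRing.RMorphism.on (isolate z).

Definition vars_but z (m : 'X_{1..n}) : R := \prod_(i | i != z) 'X_i ^+ m i.

Lemma isolateE z p :
  isolate z p = \sum_(m <- msupp p) (p@_m *: vars_but z m)%:P * 'X^(m z).
Proof.
apply: eq_bigr => m _; rewrite -mul_mpolyC polyCM -mulrA /=; congr (_ * _).
rewrite /mmap1 (bigD1 z) //= eqxx mulrC; congr (_ * _).
by rewrite rmorph_prod; apply: eq_bigr => i /negPf ->; rewrite -rmorphXn.
Qed.

Lemma horner_isolate z p : (isolate z p).['X_z] = p.
Proof.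
rewrite isolateE horner_sum [RHS]mpolyE; apply: eq_bigr => m _.
rewrite hornerM hornerC hornerXn -scalerAl; congr (_ *: _).
by rewrite [RHS]mpolyXE_id [RHS](bigD1 z) //= mulrC.
Qed.

Lemma isolate_const S z p : in_vars S p -> z \notin S -> isolate z p = p%:P.
Proof.
move=> Hp zS; have /(congr1 polyC) := horner_isolate z p; rewrite isolateE => <-.
rewrite horner_sum rmorph_sum !big_seq; apply: eq_bigr => m mp.
by rewrite hornerM hornerC hornerXn (Hp m mp z zS) !expr0 !mulr1.
Qed.

Lemma coef_isolate S z p j : in_vars (z |: S) p -> in_vars S (isolate z p)`_j.
Proof.
move=> Hp; rewrite isolateE coef_sum big_seq; apply: in_vars_sum => m mp.
rewrite coefCM coefXn -mul_mpolyC -mulrA; apply: in_varsM; first exact: in_varsC.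
apply: in_varsM; last by case: eqP => _; [apply: in_vars1|apply: in_vars0].
apply: in_vars_prod => i iz; have [iS|iS] := boolP (i \in S).
  exact: in_varsXn.
by rewrite (Hp m mp i) ?expr0; [apply: in_vars1|rewrite !inE negb_or iz].
Qed.

Definition nonzero_in S p := in_vars S p /\ p != 0.

Lemma nonzero_in_mult S : mult_closed (nonzero_in S).
Proof.
split; first by split; [apply: in_vars1|apply: oner_neq0].
by move=> p q [Hp p0] [Hq q0]; split; [apply: in_varsM|rewrite mulf_neq0].
Qed.

Lemma lead_coef_isolate S z p :
  nonzero_in (z |: S) p -> nonzero_in S (lead_coef (isolate z p)).
Proof.
move=> [Hp p0]; split; first by rewrite lead_coefE; apply: coef_isolate.
rewrite lead_coef_eq0; apply: contra p0 => /eqP E.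
by rewrite -(horner_isolate z p) E horner0.
Qed.

(** Over the field k(S), nonzero polynomials in distinct single variables form a
    regular sequence: once some of them are divided out, the remaining variables
    are still free, so the next one acts as a univariate polynomial whose leading
    coefficient is invertible. Freeness of the variable z over J is expressed by
    the stability of J under taking coefficients with respect to z. *)
Lemma separated_regular S J (F : 'I_n -> R) (zs : seq 'I_n) : is_ideal J ->
  uniq zs -> (forall z, z \in zs -> z \notin S /\ nonzero_in (z |: S) (F z)) ->
  (forall z, z \in zs -> forall p j, J p -> J (isolate z p)`_j) ->
  regular_upto (nonzero_in S) J (map F zs).
Proof.
elim: zs J => [//|z zs IH] J iJ /= /andP [zzs uzs] HF HJ.
have [zS Fz] := HF z (mem_head _ _); split=> [a JFa|].
  have [|N HN] := ideal_lead_coef (g := isolate z (F z)) (a := isolate z a) iJ.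
    by move=> j; rewrite -rmorphM; apply: HJ; rewrite ?mem_head.
  exists (lead_coef (isolate z (F z)) ^+ N).
    elim: N {HN} => [|N IHN]; first by rewrite expr0; case: (nonzero_in_mult S).
    by rewrite exprS; apply: (nonzero_in_mult S).2 => //; apply: lead_coef_isolate.
  rewrite -[X in _ * X](horner_isolate z) horner_coef mulr_sumr.
  by apply: ideal_sum => // i; rewrite mulrA; apply: idealMr.
apply: IH => //; first exact: adjoin_ideal.
  by move=> w wzs; apply: HF; rewrite inE wzs orbT.
move=> w wzs p j [c Jc]; exists (isolate w c)`_j.
have := HJ w _ _ j Jc; rewrite inE wzs orbT => /(_ isT).
rewrite rmorphB rmorphM /= coefB [isolate w (F z)](isolate_const Fz.1) ?coefMC //.
rewrite !inE negb_or (HF w _).1 ?inE ?wzs ?orbT // andbT.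
by apply: contraNneq zzs => <-.
Qed.

End Variables.

(** * Heights of primes in a polynomial ring *)

Section Dimension.
Variables (k : fieldType) (n : nat).
Local Notation R := {mpoly k[n]}.
Implicit Types (P Q : R -> Prop) (p q f : R) (S : {set 'I_n}).

Definition independent_mod P (I : finType) (e : I -> R) :=
  forall c : I -> k, P (\sum_i c i *: e i) -> forall i, c i = 0.

Definition deg_le (D : nat) p := forall m, m \in msupp p -> (mdeg m <= D)%N.

Lemma deg_leM D E p q : deg_le D p -> deg_le E q -> deg_le (D + E) (p * q).
Proof.
move=> Hp Hq m /msuppM_le /allpairsP [[m1 m2] /= [/Hp H1 /Hq H2 ->]].
by rewrite mdegD leq_add.
Qed.

Lemma deg_le_exp E f j : deg_le E f -> deg_le (j * E) (f ^+ j).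
Proof.
move=> Hf; elim: j => [|j IH]; last by rewrite exprS mulSn; apply: deg_leM.
by rewrite expr0 => m; rewrite -mpolyC1 msuppC oner_eq0 inE => /eqP ->; rewrite mdeg0.
Qed.

Lemma deg_le_leq D E p : (D <= E)%N -> deg_le D p -> deg_le E p.
Proof. by move=> DE Hp m /Hp mD; apply: leq_trans DE. Qed.

Lemma deg_le_msize p : deg_le (msize p) p.
Proof. by move=> m /msize_mdeg_lt /ltnW. Qed.

(** Independence modulo P implies linear independence in the space of
    polynomials of degree at most D, whose monomials have exponents at most D. *)
Lemma card_independent_le P (I : finType) (e : I -> R) D : P 0 ->
  independent_mod P e -> (forall i, deg_le D (e i)) -> (#|I| <= D.+1 ^ n)%N.
Proof.
move=> P0 He HD; pose M := {ffun 'I_n -> 'I_D.+1}.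
have cM : #|{: M}| = (D.+1 ^ n)%N by rewrite card_ffun !card_ord.
rewrite -cM leqNgt; apply/negP => lt.
pose mon (m : M) : 'X_{1..n} := [multinom (m i : nat) | i < n].
pose X : 'M[k]_(#|I|, #|{: M}|) :=
  \matrix_(i, j) (e (enum_val i))@_(mon (enum_val j)).
have /rowV0Pn [v /sub_kermxP vX v0] : kermx X != 0.
  rewrite -mxrank_eq0 mxrank_ker subn_eq0 -ltnNge.
  exact: leq_ltn_trans (rank_leq_col _) lt.
have /He c0 : P (\sum_i v 0 (enum_rank i) *: e i).
  suff -> : \sum_i v 0 (enum_rank i) *: e i = 0 by [].
  apply/mpolyP => m; rewrite mcoeff0 raddf_sum /=.
  under eq_bigr do rewrite mcoeffZ.
  have [mD|mD] := leqP (mdeg m) D; last first.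
    apply: big1 => i _; rewrite [(e i)@_m]memN_msupp_eq0 ?mulr0 //.
    by apply: contraL mD => /HD; rewrite -leqNgt.
  have lm i : (m i < D.+1)%N.
    by rewrite ltnS; apply: leq_trans mD; rewrite mdegE (bigD1 i) //= leq_addr.
  have Em : mon [ffun i => Ordinal (lm i)] = m.
    by apply/mnmP => i; rewrite mnmE ffunE.
  have := congr1 (fun w : 'rV[k]_#|{: M}| =>
    w 0 (enum_rank [ffun i => Ordinal (lm i)])) vX.
  rewrite !mxE => H; rewrite -[RHS]H.
  rewrite (reindex (fun i : 'I_#|I| => enum_val i)) /=; last first.
    by exists enum_rank => i _; rewrite ?enum_valK ?enum_rankK.
  by apply: eq_bigr => i _; rewrite mxE enum_valK enum_rankK Em.
case/eqP: v0; apply/rowP => i.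
by rewrite mxE -[i]enum_valK c0.
Qed.

(** The constant term of a relation lies in Q because f does, so it vanishes;
    then f can be divided out because P is prime. *)
Lemma powers_independent P Q f d (w : 'I_d -> R) :
  is_prime P -> is_ideal Q -> sub_ideal P Q -> Q f -> ~ P f ->
  (forall j, Q (w j) -> w j = 0) -> P (\sum_j w j * f ^+ j) ->
  forall j, w j = 0.
Proof.
move=> [iP _ prP] iQ sPQ Qf nPf; elim: d w => [|d IH] w Hw Pw; first by case.
have Ef : \sum_j w j * f ^+ j = w ord0 + f * \sum_j w (lift ord0 j) * f ^+ j.
  rewrite big_ord_recl expr0 mulr1 mulr_sumr; congr (_ + _).
  by apply: eq_bigr => j _; rewrite lift0 exprS mulrCA.
have w0 : w ord0 = 0.
  apply: Hw; rewrite -[w ord0](addrK (f * \sum_j w (lift ord0 j) * f ^+ j)) -Ef.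
  by apply: idealB => //; [apply: sPQ|apply: idealMr].
move: Pw; rewrite Ef w0 add0r => /prP [//|/(IH (w \o lift ord0))] H.
move=> j; case: (unliftP ord0 j) => [j' ->|-> //].
by apply: H => {}j /Hw.
Qed.

Lemma independent_extend P Q f d (I : finType) (e : I -> R) :
  is_prime P -> is_ideal Q -> sub_ideal P Q -> Q f -> ~ P f ->
  independent_mod Q e ->
  independent_mod P (fun ij : I * 'I_d => e ij.1 * f ^+ ij.2).
Proof.
move=> prP iQ sPQ Qf nPf He c; pose w (j : 'I_d) := \sum_i c (i, j) *: e i.
have -> : \sum_ij c ij *: (e ij.1 * f ^+ ij.2) = \sum_j w j * f ^+ j.
  under [RHS]eq_bigr do rewrite mulr_suml.
  rewrite exchange_big pair_bigA /=; apply: eq_bigr => -[i j] _ /=.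
  by rewrite scalerAl.
move=> /(powers_independent prP iQ sPQ Qf nPf) Hw [i j].
apply: (He (fun i => c (i, j))); rewrite -/(w j) Hw //; first by case: iQ.
move=> {}j Qw; apply: big1 => i' _.
by rewrite (He (fun i => c (i, j)) Qw) scale0r.
Qed.

(** An element f of each prime outside the preceding one behaves as a new
    variable over everything that is independent modulo the larger prime. Each
    step of the chain multiplies the size of a family by d, while the degrees
    grow only linearly in d. *)
Lemma chain_independent (C : nat -> R -> Prop) l :
  (forall i, (i <= l)%N -> is_prime (C i)) ->
  (forall i, (i < l)%N -> sub_ideal (C i) (C i.+1) /\
                          ~ sub_ideal (C i.+1) (C i)) ->
  exists E, forall (I : finType) (e : I -> R) D d,
    independent_mod (C l) e -> (forall i, deg_le D (e i)) ->
    exists (I' : finType) (e' : I' -> R),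
      [/\ #|I'| = (#|I| * d ^ l)%N, independent_mod (C 0%N) e'
        & forall i, deg_le (D + d * E) (e' i)].
Proof.
elim: l => [|l IH] pC sC.
  by exists 0%N => I e D d He HD; exists I, e; rewrite muln1 muln0 addn0.
have [||E0 HE0] := IH.
- by move=> i il; apply: pC; apply: leqW.
- by move=> i il; apply: sC; apply: leqW.
have [sub nsub] := sC l (ltnSn l).
have [f [Cf nCf]] : exists f, C l.+1 f /\ ~ C l f.
  apply: boolp.contrapT => H; apply: nsub => f Cf; apply: boolp.contrapT => nCf.
  by apply: H; exists f.
exists (msize f + E0)%N => I e D d He HD.
have He' := @independent_extend _ _ f d _ _ (pC l (leqnSn l)) _ sub Cf nCf He.
have {}He' := He' (let: And3 iQ _ _ := pC l.+1 (leqnn _) in iQ).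
have [|I' [e' [cI' ind' deg']]] := HE0 _ _ (D + d * msize f)%N d He'.
  move=> [i j] /=; apply: deg_leM => //.
  apply: (deg_le_leq (D := (j * msize f)%N)); last first.
    by apply: deg_le_exp; apply: deg_le_msize.
  by rewrite leq_mul2r ltnW ?orbT.
exists I', e'; split=> //.
  by rewrite cI' card_prod card_ord -mulnA -expnS.
by move=> i; rewrite mulnDr addnA.
Qed.

Lemma monomials_independent P S d :
  (forall p, in_vars S p -> P p -> p = 0) ->
  exists (I : finType) (e : I -> R),
    [/\ #|I| = (d ^ #|S|)%N, independent_mod P e
      & forall i, deg_le (n * d) (e i)].
Proof.
move=> HP; pose I := {ffun {i | i \in S} -> 'I_d}.
pose mon (a : I) : 'X_{1..n} :=
  [multinom oapp (fun s => a s : nat) 0%N (insub i) | i < n].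
have mon_inj : injective mon.
  move=> a b /mnmP Eab; apply/ffunP => s; apply: val_inj.
  by have := Eab (val s); rewrite !mnmE !valK.
have coefmon (c : I -> k) a : (\sum_b c b *: 'X_[mon b] : R)@_(mon a) = c a.
  rewrite raddf_sum (bigD1 a) //= mcoeffZ mcoeffX eqxx mulr1 big1 ?addr0 //.
  by move=> b ba; rewrite mcoeffZ mcoeffX (inj_eq mon_inj) (negPf ba) mulr0.
exists I, (fun a => 'X_[mon a]); split.
- by rewrite card_ffun card_ord card_sig.
- move=> c /HP H a; rewrite -(coefmon c a) H ?mcoeff0 //.
  apply: in_vars_sum => b _ m /msuppZ_le; rewrite msuppX inE => /eqP -> i iS.
  by rewrite mnmE insubN.
- move=> a m; rewrite msuppX inE => /eqP ->; rewrite mdegE.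
  rewrite -[n in (n * d)%N]card_ord -sum_nat_const; apply: leq_sum => i _.
  by rewrite mnmE; case: insubP => //= s _ _; apply: ltnW.
Qed.

(** This bounds the height of P plus the transcendence degree of its residue
    ring by n. The variables of S and the elements chosen along the chain would
    otherwise give at least d ^ n.+1 independent polynomials of degree O(d),
    more than the O(d ^ n) monomials of that degree once d is large. *)
Lemma height_add_independent P S l :
  (forall p, in_vars S p -> P p -> p = 0) ->
  prime_height_ge P l -> (#|S| + l <= n)%N.
Proof.
move=> HP [C [pC sC eC]]; have [E HE] := chain_independent pC sC.
rewrite leqNgt; apply/negP => lt.
(* The degrees below are less than c * d, and d is chosen larger than c ^ n. *)
pose c := (n + E).+1; pose d := (c ^ n).+1.
have [|I [e [cI He HD]]] := @monomials_independent (C l) S d.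
  by move=> p Sp Cp; apply: HP => //; apply/eC.
have [I' [e' [cI' He' HD']]] := HE I e _ d He HD.
have C00 : C 0%N 0 by case: (pC 0%N (leq0n _)) => [[]].
have := card_independent_le C00 He' HD'.
rewrite cI' cI -expnD => H.
have Hd : (d ^ n.+1 <= (n * d + d * E).+1 ^ n)%N.
  by apply: leq_trans H; apply: leq_pexp2l.
have Hc : ((n * d + d * E).+1 ^ n <= (c * d) ^ n)%N.
  have [->|n0] := posnP n; first by rewrite !expn0.
  by rewrite leq_exp2r // /c mulSn mulnDl [(d * E)%N]mulnC -add1n leq_add2r.
have := leq_trans Hd Hc; rewrite expnS expnMn leq_pmul2r ?expn_gt0 //.
by rewrite ltnn.
Qed.

End Dimension.

(** * Unmixedness *)

Section Unmixed.
Variables (k : fieldType) (n : nat).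
Local Notation R := {mpoly k[n]}.

(** Macaulay's unmixedness theorem, without associated primes: if u were not in
    the ideal I of hs, let K be the proper ideal I : u and S a maximal set of
    variables with no nonzero polynomial of K in k[S]. A prime over K that still
    avoids k[S] has height greater than [size hs], so more than [size hs]
    variables lie outside S. By maximality each of them contributes to K a
    polynomial over k[S] in this variable alone; these are regular over k(S) and
    kill u modulo I, which [regular_exchange] forbids. *)
Theorem unmixedness (hs : seq R) (u : R) : regular_sequence hs ->
  (forall P, is_prime P -> sub_ideal (fun f => gen_ideal hs (f * u)) P ->
     prime_height_ge P (size hs).+1) ->
  gen_ideal hs u.
Proof.
move=> reg ht; apply: boolp.contrapT => nIu.
set I := gen_ideal hs in ht nIu; have iI : is_ideal I := gen_ideal_is_ideal hs.
pose K f := I (f * u); have iK : is_ideal K := colon_ideal u iI.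
pose free S := forall p, in_vars S p -> K p -> p = 0.
have [|S /maxsetP [/boolp.asboolP freeS maxS]] :=
    @ex_maxset _ (fun S => boolp.asbool (free S)).
  exists set0; apply/boolp.asboolP => p /in_vars_set0 [c ->] Kc.
  have [->|c0] := eqVneq c 0; first exact: mpolyC0.
  case: nIu; have [_ _ KM] := iK.
  have := KM c^-1%:MP _ Kc.
  by rewrite /K -mpolyCM mulVf // mul1r.
have dK t : nonzero_in S t -> ~ K t.
  by case=> St /eqP t0 /(freeS _ St).
have [P [prP KP dP]] := prime_avoiding iK (nonzero_in_mult k S) dK.
have leS : (#|S| + (size hs).+1 <= n)%N.
  apply: (@height_add_independent _ _ P) (ht _ prP KP) => p Sp Pp.
  by apply/eqP; apply: boolp.contrapT => /negP p0; apply: (dP p).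
have exF z : exists p, z \notin S -> nonzero_in (z |: S) p /\ K p.
  apply: boolp.contrapT => nF.
  have zS : z \notin S by apply/negP => zS; apply: nF; exists 0; rewrite zS.
  have : free (z |: S).
    move=> p Sp Kp; apply/eqP; apply: boolp.contrapT => /negP p0.
    by apply: nF; exists p.
  move=> /boolp.asboolP /maxS /(_ (subsetUr _ _)) E.
  by case/negP: zS; rewrite -E setU11.
have [F HF] := boolp.choice exF.
pose zs := enum (~: S).
have szs : (size hs < size (map F zs))%N.
  rewrite size_map -cardE cardsCs setCK card_ord.
  by rewrite ltn_subRL -addnS.
have zsS z : z \in zs -> z \notin S by rewrite mem_enum inE.
have regF : regular_upto (nonzero_in S) (@zero_ideal R) (map F zs).
  apply: separated_regular.
  - exact: zero_ideal_is_ideal.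
  - exact: enum_uniq.
  - by move=> z /zsS zS; split=> //; case: (HF z zS).
  - by move=> z _ p j ->; rewrite rmorph0 coef0.
have [|t Tt It] := regular_exchange (nonzero_in_mult k S)
    (zero_ideal_is_ideal _) regF
    (regular_sequence_upto (nonzero_in_mult k S) reg) szs (u := u).
  move=> f /mapP [z /zsS zS ->]; apply/foldl_adjoin_gen.
  by case: (HF z zS).
by apply: (dK t) => //; apply/foldl_adjoin_gen.
Qed.

End Unmixed.

(** * Minors of a matrix with an added row *)

Section Minors.
Variables (A : comNzRingType) (n : nat) (M : 'M[A]_n) (w : 'rV[A]_n).
Variables (I : A -> Prop).
Hypothesis iI : is_ideal I.
Local Notation B := (add_last_row M w).

Lemma add_last_row_lift i j : B (lift ord_max i) j = M i j.
Proof. by rewrite mxE liftK. Qed.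

Lemma add_last_row_max j : B ord_max j = w 0 j.
Proof. by rewrite mxE unlift_none. Qed.

Lemma maximal_minor_max : maximal_minor B ord_max = \det M.
Proof. by congr (\det _); apply/matrixP => i j; rewrite mxE add_last_row_lift. Qed.

(** Cramer's rule for the last row: the square matrix C obtained by repeating
    column j of B has determinant zero, and its expansion along the repeated
    column relates \det M * w 0 j to the minors that involve the last row. *)
Lemma det_mul_last_row j : (forall i, I (maximal_minor B (lift ord_max i))) ->
  I (\det M * w 0 j).
Proof.
move=> HI.
pose C : 'M[A]_n.+1 := \matrix_(i, l) B i (odflt j (unlift ord_max l)).
have detC : \det C = 0.
  rewrite -det_tr (@determinant_alternate _ _ _ ord_max (lift ord_max j)) //.
    exact: neq_lift.
  by move=> i; rewrite !mxE unlift_none liftK.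
have colC : col' ord_max C = B.
  by apply/matrixP => i l; rewrite !mxE liftK.
have := expand_det_col C ord_max; rewrite detC (bigD1 ord_max) //=.
set s := \sum_(i | _) _ => Es.
have Is : I s.
  have [I0 ID IM] := iI; apply: (big_ind I) => // i.
  case: (unliftP ord_max i) => [i' -> _|->]; last by rewrite eqxx.
  rewrite /cofactor; apply: (IM); apply: (IM).
  have -> : row' (lift ord_max i') (col' ord_max C) = row' (lift ord_max i') B.
    by rewrite colC.
  exact: HI.
have : I (C ord_max ord_max * cofactor C ord_max ord_max).
  by rewrite -[X in I X](addrK s) -Es; apply: idealB => //; case: iI.
have -> : C ord_max ord_max = w 0 j by rewrite mxE unlift_none add_last_row_max.
have -> : cofactor C ord_max ord_max = \det M.
  rewrite /cofactor -signr_odd oddD addbb expr0 mul1r.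
  by rewrite -maximal_minor_max /maximal_minor colC.
by rewrite mulrC.
Qed.

Lemma maximal_minor_last_row i : (forall j, I (w 0 j)) ->
  I (maximal_minor B (lift ord_max i)).
Proof.
move=> HI; have n0 : (0 < n)%N by apply: leq_ltn_trans (ltn_ord i).
have ltn1 : (n.-1 < n)%N by rewrite ltn_predL.
rewrite /maximal_minor (expand_det_row _ (Ordinal ltn1)).
apply: ideal_sum => // j; apply: idealMr => //; rewrite mxE.
suff -> : lift (lift ord_max i) (Ordinal ltn1) = ord_max.
  by rewrite add_last_row_max.
apply: val_inj; rewrite /= /bump [(n <= i)%N]leqNgt ltn_ord add0n.
by rewrite -ltnS prednK // ltn_ord add1n prednK.
Qed.

End Minors.

(** * The union of Y and Z *)

Theorem theorem2p17 (k : fieldType) (r : nat) (hr : (3 <= r)%N)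
    (m : nat) (* n = 3 + m *)
    (X Y Z : subscheme k r)
    (h1 h2 h3 : {mpoly k[r.+1]})
    (alpha : 'M[{mpoly k[r.+1]}]_(3 + m, 3))
    (delta : 'M[{mpoly k[r.+1]}]_(3 + m, m))
    (e : int) (c : 'I_(3 + m) -> int) (b : 'I_(3 + m) -> int)
    (a : 'I_3 -> int)
    (hreg : regular_sequence [:: h1; h2; h3])
    (hkappa : homog_mx (fun j => c (lshift m j)) a (kappa_mx h1 h2 h3))
    (halpha : homog_mx a b alpha)
    (hdelta : homog_mx (fun j => c (rshift 3 j)) b delta)
    (hres : minimal_graded_resolution X (fun=> e) c b
              (col_mx (tau_mx h1 h2 h3) 0)
              (row_mx (alpha *m kappa_mx h1 h2 h3) delta)
              (signed_minors_row (B_mx h1 h2 h3 alpha delta)))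
    (hY : defined_by Y (maximal_minors_ideal (B_mx h1 h2 h3 alpha delta)))
    (hZ : defined_by Z (gen_ideal [:: h1; h2; h3]))
    (hcodim : has_height
                (gen_ideal [:: \det (row_mx alpha delta); h1; h2; h3]) 4) :
  eq_subscheme X (union_subscheme Y Z).
Proof.
set hs := [:: h1; h2; h3] in hreg hZ hcodim *.
have iH : is_ideal (gen_ideal hs) := gen_ideal_is_ideal hs.
have iX : is_ideal X := subscheme_ideal X.
case: hres => _ _ [_ _ _ imX].
set w := row_mx (tau_mx h1 h2 h3)^T 0 : 'rV_(3 + m).
set M := row_mx alpha delta in hcodim *; set D := \det M in hcodim *.
rewrite /B_mx -/M -/w in hY imX; set B := add_last_row M w in hY imX.
have hsw h : h \in hs -> exists j, w 0 j = h.
  have wj i : w 0 (lshift m i) = hs`_i by rewrite row_mxEl !mxE.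
  by rewrite !inE => /or3P [] /eqP ->;
    [exists (lshift m 0)|exists (lshift m 1)|exists (lshift m 2%:R)]; rewrite wj.
have Hw j : gen_ideal hs (w 0 j).
  case: (split_ordP j) => j' ->; last by rewrite row_mxEr mxE; case: iH.
  by rewrite row_mxEl !mxE; apply: gen_ideal_mem; apply: mem_nth.
have minorX i : X (maximal_minor B (lift ord_max i)).
  have Xg : X (signed_minors_row B 0 i).
    by apply/imX; exists (delta_mx i 0); rewrite -colE !mxE.
  have [_ _ XM] := iX; rewrite -(signrMK i.+1 (maximal_minor B _)).
  by apply: XM; rewrite mxE in Xg.
have X_min (J : {mpoly k[r.+1]} -> Prop) : is_ideal J ->
    (forall i, J (maximal_minor B (lift ord_max i))) -> sub_ideal X J.
  move=> iJ HJ f /imX [u ->]; rewrite mxE; apply: ideal_sum => // i.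
  by apply: idealMr => //; rewrite mxE; case: (iJ) => _ _; apply.
have XH : sub_ideal X (gen_ideal hs).
  by apply: X_min => // i; apply: maximal_minor_last_row.
have XJ : sub_ideal X (maximal_minors_ideal B).
  apply: X_min => [|i]; first exact: gen_ideal_is_ideal.
  by apply: gen_ideal_mem; apply: map_f; rewrite mem_enum.
have DhX u : gen_ideal hs u -> X (u * D).
  apply: (gen_ideal_min (J := fun u => X (u * D))); first exact: colon_ideal.
  move=> h /hsw [j <-]; rewrite mulrC; exact: det_mul_last_row.
have D_nzd u : gen_ideal hs (u * D) -> gen_ideal hs u.
  move=> HuD; apply: unmixedness => // P prP sP; apply: hcodim.1 => //.
  case: (prP) => iP _ _; apply: gen_ideal_min => // x; rewrite inE => /orP [/eqP ->|xh].
    by apply: sP; rewrite mulrC.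
  by apply: sP; apply: idealMr => //; apply: gen_ideal_mem.
have JXD f : maximal_minors_ideal B f -> exists u, X (f - u * D).
  apply: (gen_ideal_min (J := adjoin X D)); first exact: adjoin_ideal.
  move=> x /mapP [i _ ->]; case: (unliftP ord_max i) => [i' ->|->].
    exact: adjoin_sub.
  rewrite maximal_minor_max -[\det M]mul1r; exact: adjoin_gen.
move=> f; split=> [Xf|[/hY Yf /hZ Zf]].
  split; [apply/hY => i|apply/hZ => i]; exists 0%N; rewrite expr0 mul1r; auto.
apply: subscheme_sat => i.
have [N1 JN1] := Yf i; have [N2 HN2] := Zf i; exists (N2 + N1)%N.
have [u Xu] := JXD _ JN1.
rewrite exprD -mulrA; set x := 'X_i ^+ N1 * f in Xu *; set y := 'X_i ^+ N2.
have Hyu : gen_ideal hs (y * u).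
  apply: D_nzd; rewrite -mulrA -[y * _](subKr (y * x)) -mulrBr.
  apply: idealB => //; last by case: iH => _ _ HM; apply: HM; apply: XH.
  by rewrite /x mulrCA; case: iH => _ _ HM; apply: HM.
rewrite -(subrK (u * D) x) mulrDr mulrA; case: (iX) => _ XD XM.
by apply: XD; [apply: XM|apply: DhX].
Qed.
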